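(* There is an absolute constant $c>0$ such that for all sufficiently large $n$ there exists a tree metric $T$ with $n$ points such that any $(\tau,\rho)$-left-sided LSO for $T$ with $\rho=1$ must have $\tau\ge c\log n$ (i.e. $\tau=\Omega(\log n)$).
   Context: A tree metric $T$ with $n$ points is the shortest-path metric $\delta_T$ on the vertex set $V(T)$ of a tree with $n$ vertices and positive edge weights. A $(\tau,\rho)$-left-sided locality-sensitive ordering (left-sided LSO) for $T$ is a collection $\Sigma$ of linear orderings, each over a subset of $V(T)$, such that (i) every point $x$ of $T$ belongs to at most $\tau$ of the linear orderings in $\Sigma$; and (ii) for any two points $x,y$ of $T$ there is an ordering $\sigma\in\Sigma$ containing both $x$ and $y$ such that for all points $x',y'$ of $\sigma$ with $x'\preceq_\sigma x$ and $y'\preceq_\sigma y$ we have $\delta_T(x',y')\le\rho\cdot\delta_T(x,y)$. *)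

(* Defs.v *)
From mathcomp Require Import all_boot all_order all_algebra.
From mathcomp Require Import all_classical all_reals all_analysis.

Set Implicit Arguments.
Unset Strict Implicit.
Unset Printing Implicit Defensive.

Import Order.TTheory GRing.Theory Num.Theory.

Local Open Scope classical_set_scope.
Local Open Scope ring_scope.

(* [ucycle] also accepts the degenerate closed walks [:: x; y] that traverse an
   edge back and forth, so acyclicity excludes the cycles of size at least 3. *)
Record weighted_tree (R : realType) (V : finType) := WeightedTree {
  tree_edge : rel V;
  tree_edge_sym : symmetric tree_edge;
  tree_edge_irrefl : irreflexive tree_edge;
  tree_connected : forall x y : V, connect tree_edge x y;
  tree_acyclic : forall p : seq V, ucycle tree_edge p -> (size p <= 2)%N;
  tree_weight : V -> V -> R;
  tree_weight_sym : forall x y : V, tree_weight x y = tree_weight y x;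
  tree_weight_gt0 : forall x y : V, tree_edge x y -> 0 < tree_weight x y }.

Fixpoint walk_length (R : realType) (V : finType) (T : weighted_tree R V)
    (x : V) (p : seq V) : R :=
  if p is y :: p' then tree_weight T x y + walk_length T y p' else 0.

(* The infimum is a minimum: the set is nonempty by connectedness, and positive
   weights let one restrict to the finitely many simple paths. *)
Definition tree_dist (R : realType) (V : finType) (T : weighted_tree R V)
    (x y : V) : R :=
  inf [set walk_length T x p | p in
        [set p : seq V | path (tree_edge T) x p /\ last x p = y]].

(* A linear ordering over a subset of V is encoded by the duplicate-free list
   of the elements of that subset, in increasing order. *)
Definition ord_le (V : finType) (s : seq V) (x y : V) : bool :=
  [&& x \in s, y \in s & (index x s <= index y s)%N].

(* The collection Sigma is a list, so orderings are counted with multiplicity.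
   "Any two points" means two distinct points: for x = y the covering condition
   would further require x to come first in some ordering. *)
Definition left_sided_LSO (R : realType) (V : finType) (T : weighted_tree R V)
    (tau : nat) (rho : R) (Sigma : seq (seq V)) : Prop :=
  [/\ forall s : seq V, s \in Sigma -> uniq s,
      forall x : V, (count (fun s : seq V => x \in s) Sigma <= tau)%N
    & forall x y : V, x != y ->
        exists2 s : seq V, s \in Sigma &
          [/\ x \in s, y \in s
            & forall x' y' : V, ord_le s x' x -> ord_le s y' y ->
                tree_dist T x' y' <= rho * tree_dist T x y]].

(* Main.v *)
Require Import Defs.
From mathcomp Require Import all_boot all_order all_algebra.
From mathcomp Require Import all_classical all_reals all_analysis.
From mathcomp Require Import zify.

Import Order.TTheory GRing.Theory Num.Theory.
Local Open Scope ring_scope.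

(** The tree is the unit-weight path 0 - 1 - ... - (n-1).  If an ordering covers
    the pair x < y with rho = 1, its first point h satisfies d(x,h) <= d(x,y) and
    d(h,y) <= d(x,y), hence x <= h <= y: the first points act as hubs.  Split an
    interval of 2^k points into halves L and R: either every point of L has a hub
    in R, or some point of L has none and then every point of R has a hub in L.
    So the number F(k) of pairs (point, hub) inside such an interval satisfies
    F(k+1) >= 2 F(k) + 2^k, that is F(k) >= k 2^(k-1), and some point has at least
    k/2 hubs. *)

Section Hubs.
Local Open Scope nat_scope.

Variables (A : eqType) (S : seq A) (mem : A -> nat -> bool) (hub : A -> nat).

(** Orderings are counted, not distinct hubs: two orderings with the same hub count twice, so [tau]
    bounds the count directly. *)
Definition hub_count (a b x : nat) : nat :=
  count (fun s => mem s x && (a <= hub s < b)) S.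

Lemma hub_count_cat a b c x : a <= b <= c ->
  hub_count a c x = hub_count a b x + hub_count b c x.
Proof.
move=> abc; rewrite /hub_count; elim: S => //= s S' ->.
by case: (mem s x) => /=; lia.
Qed.

Lemma hub_count_sum_half n a b c :
    (forall x y, x < y < n -> exists2 s, s \in S &
       [/\ mem s x, mem s y & x <= hub s <= y]) ->
    a <= b <= c -> c <= n ->
  minn (b - a) (c - b) <=
  \sum_(a <= x < b) hub_count b c x + \sum_(b <= y < c) hub_count a b y.
Proof.
move=> hubS /andP[ab bc] cn.
have sum_ge (i j : nat) (F : nat -> nat) :
    (forall x, i <= x < j -> 0 < F x) -> j - i <= \sum_(i <= x < j) F x.
  move=> F0; rewrite -[leqLHS]muln1 -sum_nat_const_nat big_nat [leqRHS]big_nat.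
  exact: leq_sum.
have [/allP L|/allPn[x]] :=
    boolP (all (fun x => 0 < hub_count b c x) (index_iota a b)).
  rewrite geq_min; apply/orP; left; apply: leq_trans (leq_addr _ _).
  by apply: sum_ge => x xab; apply: L; rewrite mem_index_iota.
rewrite mem_index_iota /hub_count -has_count => xab /hasPn x_nohub.
rewrite geq_min; apply/orP; right; apply: leq_trans (leq_addl _ _).
apply: sum_ge => y ybc.
have [|s sS [sx sy shub]] := hubS x y; first by lia.
rewrite -has_count; apply/hasP; exists s => //; rewrite sy /=.
(* The hub of [s] lies in [x, y] but, since [s] contains x, not in [b, c); as y < c it falls in [a,
   b). *)
by have := x_nohub s sS; rewrite sx /=; lia.
Qed.

Lemma hub_count_sum n k a :
    (forall x y, x < y < n -> exists2 s, s \in S &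
       [/\ mem s x, mem s y & x <= hub s <= y]) ->
    a + 2 ^ k <= n ->
  k * 2 ^ k <= 2 * \sum_(a <= x < a + 2 ^ k) hub_count a (a + 2 ^ k) x.
Proof.
move=> hubS; elim: k a => // k IH a; rewrite expnS => an.
set b := a + 2 ^ k; have -> : a + 2 * 2 ^ k = b + 2 ^ k by rewrite /b; lia.
set c := b + 2 ^ k.
have abc : a <= b <= c by rewrite /c /b; lia.
have [ab bc] := andP abc.
have cn : c <= n by rewrite /c /b; lia.
rewrite (big_cat_nat ab bc) /=.
under eq_bigr do rewrite (hub_count_cat _ b c) //.
under [X in _ + X]eq_bigr do rewrite (hub_count_cat _ b c) //.
rewrite !big_split /=.
(* Of the four sums, the two with point and hub in the same half fall to [IH], the two crossed ones
   to [hub_count_sum_half]. *)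
have := hub_count_sum_half n a b c hubS abc cn.
have := IH a; rewrite -/b => /(_ (leq_trans bc cn)).
have := IH b; rewrite -/c => /(_ cn).
have -> : minn (b - a) (c - b) = 2 ^ k by rewrite /c /b; lia.
by move: (2 ^ k) => m; nia.
Qed.

End Hubs.

Section PathTree.
Variable n : nat.

Definition path_edge : rel 'I_n :=
  fun i j => (i.+1 == j :> nat) || (j.+1 == i :> nat).

(* Truncated subtraction makes one of the two terms vanish. *)
Definition ord_dist (i j : 'I_n) : nat := (i - j + (j - i))%N.

Lemma path_edge_sym : symmetric path_edge.
Proof. by move=> i j; rewrite /path_edge orbC. Qed.

Lemma path_edge_irrefl : irreflexive path_edge.
Proof. by move=> i; rewrite /path_edge; lia. Qed.

Lemma path_edge_walk (x y : 'I_n) : exists p,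
  [/\ path path_edge x p, last x p = y & size p = ord_dist x y].
Proof.
move: {2}(ord_dist x y) (erefl (ord_dist x y)) => d.
elim: d x => [|d IH] x; rewrite /ord_dist => dxy.
  by exists [::]; split=> //=; apply: val_inj => /=; lia.
have [z xz zy] : exists2 z : 'I_n, path_edge x z & ord_dist z y = d.
  have := ltn_ord y; have := ltn_ord x; move=> xn yn.
  have [xy|yx] := ltnP x y.
    have zn : (x.+1 < n)%N by lia.
    by exists (Ordinal zn); rewrite /path_edge /ord_dist /=; lia.
  (* Here y <= x, and the nonzero distance excludes equality, so [x.-1] is a true predecessor. *)
  have zn : (x.-1 < n)%N by lia.
  by exists (Ordinal zn); rewrite /path_edge /ord_dist /=; lia.
have [p [pp lp sp]] := IH z zy.
by exists (z :: p); split; rewrite /= ?xz ?sp //; lia.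
Qed.

Lemma path_edge_connected (x y : 'I_n) : connect path_edge x y.
Proof. by have [p [pp <- _]] := path_edge_walk x y; apply/connectP; exists p. Qed.

(* Both neighbours on a cycle of its largest vertex m are m - 1. *)
Lemma path_edge_acyclic (p : seq 'I_n) : ucycle path_edge p -> (size p <= 2)%N.
Proof.
case: p => // x0 p0; set p := x0 :: p0; move=> cyc.
have x0p : x0 \in p by rewrite mem_head.
case: (arg_maxnP (fun i : 'I_n => i : nat) x0p) => m mp mmax.
have [i q rotp] := rot_to mp.
move: cyc; rewrite /ucycle -(rot_cycle i) -(rot_uniq i) rotp -(size_rot i) rotp.
have qm z : z \in q -> (z <= m)%N.
  move=> zq; apply: mmax; change (z \in p).
  by rewrite -(mem_rot i) rotp inE zq orbT.
case: q qm {rotp} => // a q qm /=.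
rewrite rcons_path => /andP[/and3P[ma _ bm] /and3P[_ aq _]].
have pred_m (z : 'I_n) : path_edge m z -> (z <= m)%N -> z.+1 = m.
  by rewrite /path_edge; lia.
have am := pred_m a ma (qm a (mem_head _ _)).
rewrite path_edge_sym in bm; have lm := pred_m _ bm (qm _ (mem_last a q)).
(* The two neighbours of m coincide; if q were nonempty, a would occur again in q, against
   uniqueness. *)
have la : last a q = a by apply: val_inj; apply: succn_inj; rewrite am.
case: q la aq {qm bm lm} => // b q /= <-.
by rewrite mem_last.
Qed.

Variable R : realType.

Definition path_tree : weighted_tree R 'I_n :=
  @WeightedTree R 'I_n path_edge path_edge_sym path_edge_irrefl
    path_edge_connected path_edge_acyclic (fun _ _ => 1) (fun _ _ => erefl)
    (fun _ _ _ => ltr01).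

Lemma walk_length_path_tree x p : walk_length path_tree x p = (size p)%:R.
Proof. by elim: p x => //= y p IH x; rewrite IH -natr1 addrC. Qed.

Lemma ord_dist_path x p : path path_edge x p -> (ord_dist x (last x p) <= size p)%N.
Proof.
elim: p x => [|y p IH] x /=; first by rewrite /ord_dist; lia.
by move=> /andP[xy /IH]; move: xy; rewrite /path_edge /ord_dist; lia.
Qed.

(** The monotone walk attains the infimum; no walk is shorter, since a step changes the index by
    only one. *)
Lemma tree_dist_path_tree x y : tree_dist path_tree x y = (ord_dist x y)%:R.
Proof.
rewrite /tree_dist; set E := [set _ | _ in _]%classic.
have lbE : lbound E (ord_dist x y)%:R.
  move=> _ [p [pp <-] <-]; rewrite walk_length_path_tree ler_nat.
  exact: ord_dist_path.
have Ed : E (ord_dist x y)%:R.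
  have [p [pp lp sp]] := path_edge_walk x y.
  by exists p => //; rewrite walk_length_path_tree sp.
apply/eqP; rewrite eq_le; apply/andP; split.
  by apply: ge_inf => //; exists (ord_dist x y)%:R.
by apply: lb_le_inf => //; exists (ord_dist x y)%:R.
Qed.

Lemma left_sided_LSO_hub tau Sigma : left_sided_LSO path_tree tau 1 Sigma ->
  forall x y, (x < y < n)%N -> exists2 s, s \in Sigma &
    [/\ x \in map val s, y \in map val s & (x <= head 0%N (map val s) <= y)%N].
Proof.
move=> [_ _ cover] x y /andP[xy yn]; have xn := ltn_trans xy yn.
pose i := Ordinal xn; pose j := Ordinal yn.
have ij : i != j by rewrite -val_eqE /=; lia.
have [s sS [si sj near]] := cover i j ij; exists s => //.
split; [by apply/mapP; exists i | by apply/mapP; exists j | ].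
(* The ordering contains [i], so it is nonempty and the default 0 of [head] is never reached. *)
case: s si sj near {sS} => // h s si sj near /=.
have lehd z : z \in h :: s -> ord_le (h :: s) h z.
  by move=> zs; rewrite /ord_le mem_head zs /= eqxx.
have refl z : z \in h :: s -> ord_le (h :: s) z z.
  by move=> zs; rewrite /ord_le zs leqnn.
have := near h j (lehd i si) (refl j sj).
have := near i h (refl i si) (lehd j sj).
by rewrite mul1r !tree_dist_path_tree !ler_nat /ord_dist /=; lia.
Qed.

(** Averaging over the first 2^k vertices: each lies in at most [tau] orderings, whence k 2^k <= 2
    (2^k tau). *)
Lemma left_sided_LSO_path_tree_ge tau Sigma k :
  left_sided_LSO path_tree tau 1 Sigma -> (2 ^ k <= n)%N -> (k <= 2 * tau)%N.
Proof.
move=> lso kn; have hubS := left_sided_LSO_hub _ _ lso.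
have := @hub_count_sum _ Sigma (fun s x => x \in map val s)
  (fun s => head 0%N (map val s)) n k 0 hubS.
rewrite add0n => /(_ kn) sum_ge.
have sum_le : (\sum_(0 <= x < 2 ^ k)
    hub_count _ Sigma (fun s x => x \in map val s)
      (fun s => head 0%N (map val s)) 0 (2 ^ k) x <= 2 ^ k * tau)%N.
  rewrite -[X in (_ <= X * _)%N]subn0 -sum_nat_const_nat big_nat [leqRHS]big_nat.
  apply: leq_sum => x /andP[_ xk]; have xn := leq_trans xk kn.
  case: lso => _ /(_ (Ordinal xn)) lex _; apply: leq_trans lex.
  apply: sub_count => s /andP[+ _]; rewrite -[x]/(val (Ordinal xn)).
  by rewrite (mem_map val_inj).
have k0 : (0 < 2 ^ k)%N by rewrite expn_gt0.
by rewrite -(leq_pmul2r k0); apply: leq_trans sum_ge _; lia.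
Qed.

End PathTree.

(** With k = [trunc_log 2 n], n < 2^(k+1) <= e^(k+1), because 2 = 1 + 1 <= e. *)
Lemma ln_natr_le_trunc_log (R : realType) (n : nat) : (0 < n)%N ->
  ln (n%:R : R) <= (trunc_log 2 n).+1%:R.
Proof.
move=> n0; rewrite -[leRHS]expRK ler_ln ?posrE ?expR_gt0 ?ltr0n //.
have /ltnW nk := trunc_log_ltn n (isT : (1 < 2)%N).
apply: le_trans (_ : (2 ^ (trunc_log 2 n).+1)%:R <= _); first by rewrite ler_nat.
rewrite natrX -[X in expR X]mulr1 expRM_natl lerXn2r ?nnegrE ?expR_ge0 //.
exact: expR_ge1Dx.
Qed.

Theorem theorem1p9 (R : realType) :
  exists c : R, 0 < c /\
  exists N : nat, forall n : nat, (N <= n)%N ->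
  exists (V : finType) (T : weighted_tree R V),
    #|V| = n /\
    forall (tau : nat) (Sigma : seq (seq V)),
      left_sided_LSO T tau 1 Sigma -> c * ln (n%:R : R) <= tau%:R.
Proof.
(* The constant comes from ln n <= k + 1 <= 2k <= 4 tau with k = [trunc_log 2 n]; the middle step
   needs k >= 1, hence n >= 2. *)
exists 4^-1; split; first by rewrite invr_gt0 ltr0n.
exists 2%N => n n2; exists 'I_n, (path_tree n R); split; first exact: card_ord.
move=> tau Sigma lso; have n0 : (0 < n)%N by lia.
have k_le := left_sided_LSO_path_tree_ge _ _ _ _ _ lso (trunc_logP (isT : (1 < 2)%N) n0).
have k_gt0 : (0 < trunc_log 2 n)%N by rewrite trunc_log_gt0.
rewrite ler_pdivrMl ?ltr0n // -natrM.
apply: le_trans (ln_natr_le_trunc_log _ _ n0) _.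
by rewrite ler_nat; lia.
Qed.
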